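(* Let $\mathcal{A}=(A,[\cdot,\dots,\cdot],\alpha_1,\dots,\alpha_{n-1})$ be an $n$-ary skew-symmetric Hom-algebra (in particular, possibly an $n$-Hom-Lie algebra) with $A\neq\{0\}$, and let $p\geq 1$ be an integer. Then $\mathcal{A}$ is nilpotent of class $p$ if and only if $\{0\}\subsetneq C^{p-1}(A)\subseteq Z(A)$.
   Context: All linear spaces are over a field $\mathbb{K}$ of characteristic $0$, and $n\ge 2$. An $n$-ary skew-symmetric Hom-algebra $(A,[\cdot,\dots,\cdot],\alpha_1,\dots,\alpha_{n-1})$ is a linear space $A$ with a skew-symmetric $n$-linear map $[\cdot,\dots,\cdot]:A^n\to A$ and $n-1$ linear maps $\alpha_i:A\to A$. It is an $n$-Hom-Lie algebra if moreover, for all $x_i,y_j\in A$, $$[\alpha_1(x_1),\dots,\alpha_{n-1}(x_{n-1}),[y_1,\dots,y_n]]=\sum_{i=1}^n[\alpha_1(y_1),\dots,\alpha_{i-1}(y_{i-1}),[x_1,\dots,x_{n-1},y_i],\alpha_i(y_{i+1}),\dots,\alpha_{n-1}(y_n)].$$ The central descending series of $A$ is $C^0(A)=A$, $C^{r+1}(A)=$ the linear span of $[C^r(A),A,\dots,A]$. $\mathcal A$ is nilpotent if $C^r(A)=\{0\}$ for some $r\in\mathbb{N}$, and the smallest such $r$ is the class of nilpotency. The center is $Z(A)=\{z\in A:[x_1,\dots,x_{n-1},z]=0\ \forall x_1,\dots,x_{n-1}\in A\}$. *)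

(* Defs.v *)
From mathcomp Require Import all_boot all_order all_fingroup all_algebra.
From mathcomp Require Import classical_sets.

Set Implicit Arguments.
Unset Strict Implicit.
Unset Printing Implicit Defensive.

Import GRing.Theory.

Local Open Scope classical_set_scope.
Local Open Scope ring_scope.

Section SkewHomAlgebra.
Variables (K : fieldType) (A : lmodType K).

Definition replace_arg (n : nat) (x : {ffun 'I_n -> A}) (i : 'I_n) (a : A) :
  {ffun 'I_n -> A} := [ffun j => if j == i then a else x j].

Definition multilinear (n : nat) (f : {ffun 'I_n -> A} -> A) : Prop :=
  forall (x : {ffun 'I_n -> A}) (i : 'I_n), linear (fun a => f (replace_arg x i a)).

Definition skew_symmetric (n : nat) (f : {ffun 'I_n -> A} -> A) : Prop :=
  forall (s : 'S_n) (x : {ffun 'I_n -> A}),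
    f [ffun i => x (s i)] = (-1) ^+ s *: f x.

(* The twisting maps are part of the data and satisfy no compatibility
   condition with the bracket; n-Hom-Lie algebras are those structures that
   moreover satisfy the Hom-Nambu-Filippov identity. *)
Record skewHomAlgebra (n : nat) : Type := SkewHomAlgebra {
  bracket : {ffun 'I_n -> A} -> A;
  twist : 'I_n.-1 -> {linear A -> A};
  bracket_multilinear : multilinear bracket;
  bracket_skew : skew_symmetric bracket
}.

Definition linear_span (S : set A) : set A :=
  [set v | exists (m : nat) (c : 'I_m -> K) (s : 'I_m -> A),
     (forall i, S (s i)) /\ v = \sum_(i < m) c i *: s i].

Variables (n : nat) (L : skewHomAlgebra n).

(* The arguments are indexed from 0 to n - 1. Since the first and last indices
   are designated by their values, this definition and that of [center] have
   the intended meaning only when 0 < n. *)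
Fixpoint central_descending (r : nat) : set A :=
  if r is r'.+1 then
    linear_span (bracket L @`
      [set x : {ffun 'I_n -> A} |
         forall i : 'I_n, i = 0%N :> nat -> central_descending r' (x i)])
  else [set: A].

Definition center : set A :=
  [set z | forall x : {ffun 'I_n -> A},
     (forall i : 'I_n, i = n.-1 :> nat -> x i = z) -> bracket L x = 0].

Definition nilpotent : Prop :=
  exists r : nat, central_descending r = [set 0].

Definition nilpotent_of_class (p : nat) : Prop :=
  [/\ nilpotent, central_descending p = [set 0]
    & forall r : nat, central_descending r = [set 0] -> (p <= r)%N].

End SkewHomAlgebra.

(* Main.v *)
Require Import Defs.
From mathcomp Require Import all_boot all_order all_fingroup all_algebra.
From mathcomp Require Import classical_sets.

Set Implicit Arguments.
Unset Strict Implicit.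
Unset Printing Implicit Defensive.

Import GRing.Theory.

Local Open Scope classical_set_scope.
Local Open Scope ring_scope.

Section CentralDescending.
Variables (K : fieldType) (A : lmodType K).

(** A span is zero exactly when its generators are, so $C^{q+1}(A)=0$ says that every bracket whose
    first entry lies in $C^q(A)$ vanishes; by skew-symmetry this means $C^q(A)\subseteq Z(A)$
    ([central_descendingS_eq0]). A series that reaches zero stays there
    ([central_descending_eq0_le]), so for $p=q+1$ the minimality of $p$ amounts to $C^q(A)\ne 0$. *)

Lemma linear_span0 (S : set A) : linear_span S 0.
Proof.
exists 0%N, (fun=> 0), (fun=> 0).
by split; [case | rewrite big_ord0].
Qed.

Lemma sub_linear_span (S : set A) : S `<=` linear_span S.
Proof.
move=> v Sv; exists 1%N, (fun=> 1), (fun=> v).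
by split=> //; rewrite big_ord1 scale1r.
Qed.

Lemma linear_span_eq0 (S : set A) : linear_span S = [set 0] <-> S `<=` [set 0].
Proof.
split=> [<-|S0]; first exact: sub_linear_span.
rewrite eqEsubset; split=> [v [m [c [s [Ss ->]]]]|_ ->]; last exact: linear_span0.
by apply: big1 => i _; rewrite (S0 _ (Ss i)) scaler0.
Qed.

Variables (n : nat) (L : skewHomAlgebra A n).

(** Permuting the entries only multiplies the bracket by a sign, which is a nonzero scalar. *)
Lemma bracket_perm_eq0 (s : 'S_n) (x : {ffun 'I_n -> A}) :
  bracket L [ffun i => x (s i)] = 0 <-> bracket L x = 0.
Proof.
rewrite bracket_skew; split=> [/eqP|->]; last by rewrite scaler0.
by rewrite scaler_eq0 signr_eq0 => /eqP.
Qed.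

Lemma bracket_arg0 (x : {ffun 'I_n -> A}) (i : 'I_n) :
  x i = 0 -> bracket L x = 0.
Proof.
(* Since [x i = 0], linearity in slot [i] at scalar 1 and vectors 0, 0 reads
   [bracket L x = bracket L x + bracket L x]. *)
move=> xi0; have /(_ 1 0 0) := bracket_multilinear L x i.
have -> : replace_arg x i (1 *: 0 + 0) = x.
  by apply/ffunP => j; rewrite ffunE scaler0 addr0; case: eqP => [->|].
have -> : replace_arg x i 0 = x.
  by apply/ffunP => j; rewrite ffunE; case: eqP => [->|].
by rewrite scale1r -[LHS]addr0 => /addrI.
Qed.

Lemma central_descending0 (r : nat) : central_descending L r 0.
Proof. by case: r => [//|r]; apply: linear_span0. Qed.

Hypothesis n_gt0 : (0 < n)%N.

(* The series constrains the first argument of the bracket and the center the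
   last one; skew-symmetry exchanges the two. *)
Lemma central_descendingS_eq0 (r : nat) :
  central_descending L r.+1 = [set 0] <-> central_descending L r `<=` center L.
Proof.
have n1_lt : (n.-1 < n)%N by rewrite prednK.
pose s := tperm (Ordinal n_gt0) (Ordinal n1_lt).
apply: iff_trans (linear_span_eq0 _) _; split=> [C0 z Cz x xz|CZ _ [x Cx <-]].
(* The swap [s] brings [z] from the last slot to the first, giving a generator of the next term. *)
- apply/(bracket_perm_eq0 s)/C0; exists [ffun i => x (s i)] => //= i i0.
  have -> : i = Ordinal n_gt0 by apply: val_inj.
  by rewrite ffunE tpermL xz.
- apply/(bracket_perm_eq0 s)/(CZ (x (Ordinal n_gt0))); first exact: Cx.
  move=> i i1; have -> : i = Ordinal n1_lt by apply: val_inj.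
  by rewrite ffunE tpermR.
Qed.

(** Zero is central, because a bracket with a zero entry vanishes; hence each zero term makes the
    next one zero. *)
Lemma central_descending_eq0_le (q r : nat) : (q <= r)%N ->
  central_descending L q = [set 0] -> central_descending L r = [set 0].
Proof.
move=> /subnK <- Cq0; elim: (r - q)%N => [//|k IHk].
have n1_lt : (n.-1 < n)%N by rewrite prednK.
rewrite addSn; apply/central_descendingS_eq0; rewrite IHk => _ -> x x0.
by apply: (@bracket_arg0 _ (Ordinal n1_lt)); apply: x0.
Qed.

End CentralDescending.

Theorem proposition6 (K : fieldType) (char0 : [pchar K] =i pred0)
    (n : nat) (n_ge2 : (2 <= n)%N) (A : lmodType K)
    (L : skewHomAlgebra A n) (A_neq0 : [set: A] <> [set 0])
    (p : nat) (p_ge1 : (1 <= p)%N) :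
  nilpotent_of_class L p <->
  [set 0] `<` central_descending L (p - 1)%N /\
  central_descending L (p - 1)%N `<=` center L.
Proof.
have n_gt0 : (0 < n)%N := ltnW n_ge2.
case: p p_ge1 => [//|q] _; rewrite subn1 /=.
have C0 : [set 0] `<=` central_descending L q.
  by move=> _ ->; apply: central_descending0.
split=> [[_ Cq1 minq]|[[_ nC0] /(central_descendingS_eq0 L n_gt0) Cq1]].
  split; last exact/(central_descendingS_eq0 L n_gt0).
  (* Were $C^q(A)$ zero, minimality of the class would give [q.+1 <= q]. *)
  split=> // C0'; have /minq : central_descending L q = [set 0].
    by rewrite eqEsubset; split.
  by rewrite ltnn.
split=> // [|r Cr0]; first by exists q.+1.
(* A zero term at some [r <= q] would persist up to [q], against $C^q(A)\ne 0$. *)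
rewrite ltnNge; apply/negP => le_rq; apply: nC0.
by rewrite (central_descending_eq0_le n_gt0 le_rq Cr0).
Qed.
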